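(* The class of fractional gradient systems is strictly wider than the class of gradient systems: every gradient system is a fractional gradient system (of order $\alpha=1$), and there exist dynamical systems that are fractional gradient systems for some order $\alpha>0$ but are not gradient systems.
   Context: A dynamical system $dx_i/dt=F_i(x)$, $i=1,\dots,n$, on (a subset of) $\mathbb{R}^n$ is called a gradient system if the 1-form $\omega=\sum_iF_i\,dx_i$ is exact, $\omega=-dV$, i.e. $F_i=-\partial V/\partial x_i$ for all $i$, for some continuously differentiable function $V$. It is called a fractional gradient system of order $\alpha$ if the fractional 1-form $\omega_\alpha=\sum_iF_i(dx_i)^\alpha$ is exact, $\omega_\alpha=-d^\alpha V$ with $d^\alpha V=\sum_i(\mathbf{D}^\alpha_{x_i}V)(dx_i)^\alpha$ (the symbols $(dx_i)^\alpha$ being basis elements), i.e. $F_i=-\mathbf{D}^\alpha_{x_i}V$ for all $i$, for some continuously differentiable function $V$. Here $\mathbf{D}^{\alpha}_{x}$ is the Riemann–Liouville derivative with initial point $0$, $$\mathbf{D}^{\alpha}_{x}f(x)=\frac{1}{\Gamma(m-\alpha)}\frac{\partial^m}{\partial x^m}\int_0^x\frac{f(y)\,dy}{(x-y)^{\alpha-m+1}},$$ where $m$ is the smallest whole number $\ge\alpha$, acting on the indicated variable; for integer $\alpha$ it is the ordinary partial derivative of order $\alpha$. *)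

(* Defs.v *)
From HB Require Import structures.
From mathcomp Require Import all_boot all_order all_algebra.
From mathcomp Require Import all_classical all_reals all_analysis.
Set Implicit Arguments.
Unset Strict Implicit.
Unset Printing Implicit Defensive.
Import Order.TTheory GRing.Theory Num.Theory numFieldNormedType.Exports.
Local Open Scope classical_set_scope.
Local Open Scope ring_scope.

(* Euler's integral; the value is the Gamma function only for 0 < s, which is
   all that is used: below it is evaluated at m - alpha in ]0, 1[. *)
Definition Gamma (R : realType) (s : R) : R :=
  \int[@lebesgue_measure R]_(t in `]0, +oo[) (t `^ (s - 1) * expR (- t)).

(* The smallest whole number m >= alpha (for alpha >= 0). *)
Definition RL_order (R : realType) (alpha : R) : nat := absz (Num.ceil alpha).

(* f is m times differentiable near x; needed because derive1n m f is a total
   function with an arbitrary value where the derivative does not exist. *)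
Definition derivable_n (R : realType) (m : nat) (f : R -> R) (x : R) : Prop :=
  forall k : nat, (k < m)%N -> \forall t \near x, derivable (derive1n k f) t 1.

Definition RL_kernel (R : realType) (alpha : R) (f : R -> R) (x y : R) : R :=
  f y / (x - y) `^ (alpha - (RL_order alpha)%:R + 1).

Definition RL_integral (R : realType) (alpha : R) (f : R -> R) (x : R) : R :=
  \int[@lebesgue_measure R]_(y in `]0, x[) RL_kernel alpha f x y.

Definition RL_deriv (R : realType) (alpha : R) (f : R -> R) (x : R) : R :=
  let m := RL_order alpha in
  if alpha == m%:R then derive1n m f x
  else (Gamma (m%:R - alpha))^-1 * derive1n m (RL_integral alpha f) x.

(* The derivative of order alpha at x makes sense for a function f given only
   on A. For non-integer alpha the power (x - y) ^ (alpha - m + 1) is real only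
   for y < x, so the initial point 0 must lie to the left of x, and f is needed
   on all of ]0, x]. *)
Definition RL_derivable (R : realType) (alpha : R) (A : set R) (f : R -> R)
    (x : R) : Prop :=
  let m := RL_order alpha in
  if alpha == m%:R then derivable_n m f x
  else [/\ 0 < x,
           `]0, x] `<=` A,
           \forall t \near x, (@lebesgue_measure R).-integrable `]0, t[
                                (EFin \o RL_kernel alpha f t)
         & derivable_n m (RL_integral alpha f) x].

Definition upd (R : realType) (n : nat) (x : 'rV[R]_n) (i : 'I_n) (s : R) :
    'rV[R]_n :=
  \row_j (if j == i then s else x ord0 j).

Definition RL_partial (R : realType) (n : nat) (alpha : R) (i : 'I_n)
    (V : 'rV[R]_n -> R) (x : 'rV[R]_n) : R :=
  RL_deriv alpha (fun s => V (upd x i s)) (x ord0 i).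

Definition RL_partial_exists (R : realType) (n : nat) (alpha : R) (i : 'I_n)
    (D : set 'rV[R]_n) (V : 'rV[R]_n -> R) (x : 'rV[R]_n) : Prop :=
  RL_derivable alpha [set s | D (upd x i s)] (fun s => V (upd x i s))
    (x ord0 i).

Definition partial (R : realType) (n : nat) (i : 'I_n) (V : 'rV[R]_n -> R)
    (x : 'rV[R]_n) : R :=
  'D_(delta_mx ord0 i) V x.

Definition continuously_differentiable (R : realType) (n : nat)
    (D : set 'rV[R]_n) (V : 'rV[R]_n -> R) : Prop :=
  forall x, D x ->
    differentiable V x /\ forall i : 'I_n, {for x, continuous (partial i V)}.

(* The coefficients of d V in the basis d x_i and of d^alpha V in the basis
   (d x_i)^alpha. *)
Definition differential_form (R : realType) (n : nat) (V : 'rV[R]_n -> R)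
    (x : 'rV[R]_n) : 'rV[R]_n :=
  \row_i partial i V x.

Definition fractional_differential_form (R : realType) (n : nat) (alpha : R)
    (V : 'rV[R]_n -> R) (x : 'rV[R]_n) : 'rV[R]_n :=
  \row_i RL_partial alpha i V x.

(* F is the right-hand side of the system d x_i / d t = F_i(x) on D; only the
   values of F and V on D matter. *)
Definition gradient_system (R : realType) (n : nat) (D : set 'rV[R]_n)
    (F : 'rV[R]_n -> 'rV[R]_n) : Prop :=
  exists V : 'rV[R]_n -> R,
    continuously_differentiable D V /\
    forall x, D x -> F x = - differential_form V x.

Definition fractional_gradient_system (R : realType) (n : nat) (alpha : R)
    (D : set 'rV[R]_n) (F : 'rV[R]_n -> 'rV[R]_n) : Prop :=
  exists V : 'rV[R]_n -> R,
    continuously_differentiable D V /\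
    forall x, D x ->
      (forall i : 'I_n, RL_partial_exists alpha i D V x) /\
      F x = - fractional_differential_form alpha V x.

(* Main.v *)
Require Import Defs.
From HB Require Import structures.
From mathcomp Require Import all_boot all_order all_algebra.
From mathcomp Require Import all_classical all_reals all_analysis.
Import Order.TTheory GRing.Theory Num.Theory numFieldNormedType.Exports.
Local Open Scope classical_set_scope.
Local Open Scope ring_scope.

(** The order [2] separates the two classes: with [V = x0^2 x1] on the plane,
    the system [F = - (d^2 V / dx0^2, d^2 V / dx1^2) = - (2 x1, 0)] is a
    fractional gradient system of order [2].  If it were a gradient system with
    potential [W], then [W] would be independent of [x1], hence so would be
    [dW / dx0], which is [2 x1]. *)

Lemma upd_id (R : realType) (n : nat) (x : 'rV[R]_n) (i : 'I_n) :
  upd x i (x ord0 i) = x.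
Proof. by apply/rowP => j; rewrite !mxE; case: eqP => // ->. Qed.

Lemma updC (R : realType) (n : nat) (x : 'rV[R]_n) (i j : 'I_n) (s t : R) :
  i != j -> upd (upd x i s) j t = upd (upd x j t) i s.
Proof.
move=> ij; apply/rowP => k; rewrite !mxE.
by have [->|//] := eqVneq k i; rewrite (negPf ij).
Qed.

(** Moving along a slice is moving along the line with direction [delta_mx ord0 i]; this links
    derivatives of slices to directional derivatives. *)
Lemma upd_shift (R : realType) (n : nat) (x : 'rV[R]_n) (i : 'I_n) (s h : R) :
  upd x i (h + s) = h *: delta_mx ord0 i + upd x i s.
Proof.
apply/rowP => j; rewrite !mxE eqxx /=.
by case: eqP => _; rewrite ?mulr1 // mulr0 add0r.
Qed.

(** The quotients agree before any limit is taken, so both the existence and the value of the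
    derivative transfer between the slice and [V]. *)
Lemma difference_quotient_upd (R : realType) (n : nat) (V : 'rV[R]_n -> R)
    (x : 'rV[R]_n) (i : 'I_n) (s : R) :
  (fun h : R => h^-1 *: (((fun t => V (upd x i t)) \o shift s) (h *: 1)
                         - V (upd x i s))) =
  (fun h : R => h^-1 *: ((V \o shift (upd x i s)) (h *: delta_mx ord0 i)
                         - V (upd x i s))).
Proof.
by apply/funext => h /=; rewrite [h *: 1]mulr1 upd_shift.
Qed.

Lemma derivable_upd (R : realType) (n : nat) (V : 'rV[R]_n -> R)
    (x : 'rV[R]_n) (i : 'I_n) (s : R) :
  derivable (fun t => V (upd x i t)) s 1 =
  derivable V (upd x i s) (delta_mx ord0 i).
Proof. by rewrite /derivable difference_quotient_upd. Qed.

Lemma derive1_upd (R : realType) (n : nat) (V : 'rV[R]_n -> R)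
    (x : 'rV[R]_n) (i : 'I_n) (s : R) :
  (fun t => V (upd x i t))^`()%classic s = partial i V (upd x i s).
Proof.
by rewrite derive1E /partial /derive difference_quotient_upd.
Qed.

Lemma partialE (R : realType) (n : nat) (V : 'rV[R]_n -> R) (x : 'rV[R]_n)
    (i : 'I_n) :
  partial i V x = (fun t => V (upd x i t))^`()%classic (x ord0 i).
Proof. by rewrite derive1_upd upd_id. Qed.

Lemma continuous_upd (R : realType) (n : nat) (x : 'rV[R]_n) (i : 'I_n)
    (s : R) :
  {for s, continuous (upd x i)}.
Proof.
have -> : upd x i = fun t : R => t *: delta_mx ord0 i + upd x i 0.
  by apply/funext => t; rewrite -upd_shift addr0.
by apply: cvgD; [apply: cvgZr_tmp; exact: cvg_id|exact: cvg_cst].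
Qed.

(** At a natural order the test [alpha == m%:R] succeeds, so the Riemann-Liouville notions reduce to
    iterated ordinary derivatives of a slice. *)
Lemma RL_order_nat (R : realType) (m : nat) : RL_order (m%:R : R) = m.
Proof. by rewrite /RL_order pmulrn intrKceil. Qed.

Lemma RL_partial_nat (R : realType) (n m : nat) (i : 'I_n) (V : 'rV[R]_n -> R)
    (x : 'rV[R]_n) :
  RL_partial m%:R i V x = derive1n m (fun s => V (upd x i s)) (x ord0 i).
Proof. by rewrite /RL_partial /RL_deriv RL_order_nat eqxx. Qed.

Lemma RL_partial_exists_nat (R : realType) (n m : nat) (i : 'I_n)
    (D : set 'rV[R]_n) (V : 'rV[R]_n -> R) (x : 'rV[R]_n) :
  RL_partial_exists m%:R i D V x =
  derivable_n m (fun s => V (upd x i s)) (x ord0 i).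
Proof. by rewrite /RL_partial_exists /RL_derivable RL_order_nat eqxx. Qed.

(** The same potential serves for both notions. *)
Lemma gradient_system_fractional1 (R : realType) (n : nat) (D : set 'rV[R]_n)
    (F : 'rV[R]_n -> 'rV[R]_n) :
  open D -> gradient_system D F -> fractional_gradient_system 1 D F.
Proof.
rewrite -[1]/(1%:R) => oD [V [dV FE]]; exists V; split=> // x Dx; split=> [i|].
  rewrite RL_partial_exists_nat => -[|//] _.
  (* Derivability is required near [x ord0 i], not only at it; as [D] is open, the slice stays in
     [D] there. *)
  have : \forall t \near x ord0 i, D (upd x i t).
    apply: continuous_upd; rewrite upd_id.
    by apply: open_nbhs_nbhs.
  apply: filterS => t /dV [dVt _].
  by rewrite derive1n0 derivable_upd; exact: diff_derivable.
rewrite FE//; congr (- _); apply/rowP => i.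
by rewrite !mxE RL_partial_nat derive1n1 -partialE.
Qed.

Lemma derive1_mulr (R : realType) (c : R) :
  (fun s : R => c * s)^`()%classic = (fun=> c).
Proof.
apply/funext => s; rewrite derive1E deriveMl//.
by rewrite derive_id [LHS]mulr1.
Qed.

Lemma derive1_sqr_mul (R : realType) (c : R) :
  (fun s : R => s ^+ 2 * c)^`()%classic = (fun s => 2 * c * s).
Proof.
apply/funext => s; rewrite derive1E deriveMr// exp_derive.
by rewrite /GRing.scale/= mulr1 expr1 mulrA [c * _]mulrC.
Qed.

Definition cubic_potential (R : realType) (x : 'rV[R]_2) : R :=
  x ord0 ord0 ^+ 2 * x ord0 ord_max.

Definition cubic_field (R : realType) (x : 'rV[R]_2) : 'rV[R]_2 :=
  - \row_j (if j == ord0 then 2 * x ord0 ord_max else 0).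

Lemma cubic_potential_upd0 (R : realType) (x : 'rV[R]_2) :
  (fun s => cubic_potential R (upd x ord0 s)) =
  (fun s => s ^+ 2 * x ord0 ord_max).
Proof. by apply/funext => s; rewrite /cubic_potential !mxE. Qed.

Lemma cubic_potential_upd1 (R : realType) (x : 'rV[R]_2) :
  (fun s => cubic_potential R (upd x ord_max s)) =
  (fun s => x ord0 ord0 ^+ 2 * s).
Proof. by apply/funext => s; rewrite /cubic_potential !mxE. Qed.

Lemma ord2P (P : 'I_2 -> Prop) : P ord0 -> P ord_max -> forall i, P i.
Proof.
move=> P0 P1 [[|[|//]] lt_i].
  by rewrite (_ : Ordinal _ = ord0)//; exact: val_inj.
by rewrite (_ : Ordinal _ = ord_max)//; exact: val_inj.
Qed.

Lemma cubic_potential_C1 (R : realType) :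
  continuously_differentiable setT (cubic_potential R).
Proof.
have dc (x : 'rV[R]_2) j : differentiable (fun y : 'rV[R]_2 => y ord0 j) x.
  exact: differentiable_coord.
have cc (x : 'rV[R]_2) j : {for x, continuous (fun y : 'rV[R]_2 => y ord0 j)}.
  exact: coord_continuous.
move=> x _; split.
  apply: differentiableM; last exact: dc.
  exact: (differentiableM (dc x ord0) (dc x ord0)).
apply: ord2P.
  have -> : partial ord0 (cubic_potential R) =
      (fun y => 2 * y ord0 ord_max * y ord0 ord0).
    by apply/funext => y; rewrite partialE cubic_potential_upd0 derive1_sqr_mul.
  apply: continuousM; last exact: cc. apply: continuousM; last exact: cc.
  exact: cst_continuous.
have -> : partial ord_max (cubic_potential R) = (fun y => y ord0 ord0 ^+ 2).
  by apply/funext => y; rewrite partialE cubic_potential_upd1 derive1_mulr.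
exact: (continuousM (cc x _) (cc x _)).
Qed.

Lemma cubic_field_fractional2 (R : realType) :
  fractional_gradient_system 2 setT (cubic_field R).
Proof.
exists (cubic_potential R); split; first exact: cubic_potential_C1.
move=> x _; split.
  apply: ord2P; rewrite RL_partial_exists_nat.
    (* Order 2 asks that the slice ([k = 0]) and its first derivative ([k = 1]) be derivable. *)
    rewrite cubic_potential_upd0 => -[|[|//]] _; apply: filterE => t.
      by rewrite derive1n0.
    by rewrite derive1n1 derive1_sqr_mul.
  rewrite cubic_potential_upd1 => -[|[|//]] _; apply: filterE => t.
    by rewrite derive1n0.
  by rewrite derive1n1 derive1_mulr.
congr (- _); apply/rowP; apply: ord2P; rewrite !mxE RL_partial_nat derive1nS.
  by rewrite cubic_potential_upd0 derive1n1 derive1_sqr_mul derive1_mulr.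
by rewrite cubic_potential_upd1 derive1n1 derive1_mulr derive1_cst.
Qed.

(** This replaces the symmetry of mixed second derivatives, which a C^1 potential may lack: [W] is
    constant along direction [j], so its [i]-slices through [x] and [upd x j t] are the same
    function. *)
Lemma partial_indep (R : realType) (n : nat) (i j : 'I_n) (W : 'rV[R]_n -> R)
    (x : 'rV[R]_n) (t : R) :
    i != j -> (forall y, derivable W y (delta_mx ord0 j)) ->
    (forall y, partial j W y = 0) ->
  partial i W (upd x j t) = partial i W x.
Proof.
move=> ij dW W0.
have Wcst y s : W (upd y j s) = W y.
  (* Both sides become values of one [j]-slice, whose derivative vanishes everywhere. *)
  rewrite -{2}(upd_id _ _ y j).
  apply: (@is_derive_0_is_cst R (fun r => W (upd y j r))) => r.
  apply: DeriveDef; first by rewrite derivable_upd.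
  by rewrite -derive1E derive1_upd.
(* Since [i != j], both slices are differentiated at the same point [x ord0 i]. *)
rewrite !partialE mxE (negPf ij).
congr (derive1 _ _); apply/funext => s.
by rewrite updC 1?eq_sym// Wcst.
Qed.

Lemma cubic_field_not_gradient (R : realType) :
  ~ gradient_system setT (cubic_field R).
Proof.
case=> W [dW FE].
have WE x i : partial i W x = if i == ord0 then 2 * x ord0 ord_max else 0.
  by have /rowP/(_ i) := FE x I; rewrite !mxE => /oppr_inj.
(* The two points differ only in the last coordinate, 1 against 0, where [2 * x ord0 ord_max] takes
   the values 2 and 0. *)
have : partial ord0 W (upd 0 ord_max 1) = partial ord0 W 0.
  apply: partial_indep => // y.
  by apply: diff_derivable; exact: (dW y I).1.
by rewrite !WE !mxE/= mulr0 mulr1 => /eqP; rewrite pnatr_eq0.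
Qed.

Theorem mainTheorem5 (R : realType) :
  (forall (n : nat) (D : set 'rV[R]_n) (F : 'rV[R]_n -> 'rV[R]_n),
     open D -> gradient_system D F -> fractional_gradient_system 1 D F) /\
  (exists (n : nat) (D : set 'rV[R]_n) (F : 'rV[R]_n -> 'rV[R]_n) (alpha : R),
     [/\ open D,
         0 < alpha,
         fractional_gradient_system alpha D F
       & ~ gradient_system D F]).
Proof.
split; first exact: gradient_system_fractional1.
exists 2%N, setT, (cubic_field R), 2; split => //.
- exact: openT.
- exact: cubic_field_fractional2.
- exact: cubic_field_not_gradient.
Qed.
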